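(* Consider $\min_{y\in\mathbb R^{n_y}}\sum_{i\in\mathcal I}f_i(y)$ with nonempty solution set $\mathcal Y^\star$, where each $f_i:\mathbb R^{n_y}\to\mathbb R$ depends only on $(y_p)_{p\in\mathcal N(i)}$, and the push-sum iteration described in the context. Assume: for all $k$ and $p$, (i) every $i\in\mathcal V_p$ has a self-loop in $\mathcal G^{\mathrm D,k}_p$, (ii) $\mathbf 1_{N_p}^\top W^k_p=\mathbf 1_{N_p}^\top$, (iii) $[W^k_p]_{i_p,j_p}\ge\nu$ for every edge from $j$ to $i$ in $\mathcal G^{\mathrm D,k}_p$, for some $\nu>0$; there is an integer $Q>0$ such that for every $p$ the graph $\bigcup_{t=kQ}^{(k+1)Q-1}\mathcal G^{\mathrm D,t}_p$ is strongly connected for all $k$; each $f_i$ is convex and there is $L>0$ with $\|g\|\le L$ for all $y$ and all $g\in\partial f_i(y)$; $(\gamma^k)$ is positive and non-increasing with $\sum_k\gamma^k=\infty$, $\sum_k(\gamma^k)^2<\infty$. Then the estimates converge to a common solution: there is $y^\star\in\mathcal Y^\star$ such that $\boldsymbol y^k_{i,p}\to y^\star_p$ for all $p$ and all $i\in\mathcal V_p$.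
   Context: Agents $\mathcal I=\{1,\dots,I\}$; $y=\mathrm{col}((y_p)_{p\in\mathcal P})$, $y_p\in\mathbb R^{n_{y_p}}$; $\mathcal N(i)$ is the set of blocks on which $f_i$ depends. For each $p$, a fixed set $\mathcal V_p\subseteq\mathcal I$ with $\{i:p\in\mathcal N(i)\}\subseteq\mathcal V_p$, $N_p=|\mathcal V_p|$, $i_p$ the position of $i$ in $\mathcal V_p$. For each $k$, $\mathcal G^{\mathrm D,k}_p$ is a directed graph on $\mathcal V_p$ (a subgraph of the time-$k$ communication graph) with compliant weight matrix $W^k_p\in\mathbb R^{N_p\times N_p}$ ($[W^k_p]_{i_p,j_p}>0$ iff there is an edge from $j$ to $i$, else $0$). A union of graphs on the same vertex set takes the union of edges. Iteration: for all $i$ and $p$ with $i\in\mathcal V_p$, initialize $\boldsymbol z^0_{i,p}\in\mathbb R^{n_{y_p}}$ arbitrary, $q^0_{i,p}=1$, and for $k\ge0$: $q^{k+1}_{i,p}=\sum_{j\in\mathcal V_p}[W^k_p]_{i_p,j_p}q^k_{j,p}$; $\boldsymbol w^{k+1}_{i,p}=\sum_{j\in\mathcal V_p}[W^k_p]_{i_p,j_p}\boldsymbol z^k_{j,p}$; $\boldsymbol y^{k+1}_{i,p}=\boldsymbol w^{k+1}_{i,p}/q^{k+1}_{i,p}$; $\boldsymbol z^{k+1}_{i,p}=\boldsymbol w^{k+1}_{i,p}-\gamma^k\boldsymbol g^{k+1}_{i,p}$, where $\boldsymbol g^{k+1}_{i,p}$ is the $y_p$-block of a subgradient of $f_i$ at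 $\tilde{\boldsymbol y}^{k+1}_i$, i.e., at the point whose block $p$ is $\boldsymbol y^{k+1}_{i,p}$ for the blocks $p$ with $i\in\mathcal V_p$ (on which $f_i$ depends). *)

(* Defs.v *)
From HB Require Import structures.
From mathcomp Require Import all_boot all_order all_algebra.
From mathcomp Require Import all_classical all_reals all_analysis.
Set Implicit Arguments. Unset Strict Implicit. Unset Printing Implicit Defensive.
Import Order.TTheory GRing.Theory Num.Theory.
Local Open Scope ring_scope.

(* A point y = col((y_p)_p) of R^{n_y}: block p lives in R^{ny p},
   represented by its coordinates 'I_(ny p) -> R. *)
Definition bvec (R : realType) (P : nat) (ny : 'I_P -> nat) :=
  forall p : 'I_P, 'I_(ny p) -> R.

Section BlockVec.
Variables (R : realType) (P : nat) (ny : 'I_P -> nat).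

Definition bcomb (t : R) (x y : bvec R ny) : bvec R ny :=
  fun p j => t * x p j + (1 - t) * y p j.

Definition bdot (x y : bvec R ny) : R := \sum_(p < P) \sum_(j < ny p) x p j * y p j.
Definition bnorm (x : bvec R ny) : R := Num.sqrt (bdot x x).

Definition convex_fun (f : bvec R ny -> R) : Prop :=
  forall (x y : bvec R ny) (t : R), 0 <= t -> t <= 1 ->
    f (bcomb t x y) <= t * f x + (1 - t) * f y.

Definition is_subgrad (f : bvec R ny -> R) (y g : bvec R ny) : Prop :=
  forall z : bvec R ny, f y + bdot g (fun p j => z p j - y p j) <= f z.

Definition depends_only (f : bvec R ny -> R) (S : {set 'I_P}) : Prop :=
  forall x y : bvec R ny, (forall p, p \in S -> x p = y p) -> f x = f y.
End BlockVec.

(* Union over t in [kQ, (k+1)Q - 1] of the graphs G^{D,t}_p on V_p: edge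
   from a to b iff a, b \in V_p and [W^t_p]_{b,a} > 0 for some such t
   (compliant weights: positive weight <=> edge). *)
Definition union_edge (R : realType) (I P : nat)
  (W : nat -> 'I_P -> 'I_I -> 'I_I -> R) (V : 'I_P -> {set 'I_I})
  (Q k : nat) (p : 'I_P) : rel 'I_I :=
  fun a b => [&& a \in V p, b \in V p & [exists t : 'I_Q, 0 < W (k * Q + t)%N p b a]].

(* strong connectivity of a digraph on vertex set V (edges inside V) *)
Definition strongly_connected (I : nat) (V : {set 'I_I}) (e : rel 'I_I) : Prop :=
  forall a b, a \in V -> b \in V -> connect e a b.

(* Main.v *)
(** Dividing by the push-sum weights turns each coordinate of the iteration into
    a perturbed averaging [r' = A r - e] with [A] row-stochastic: the ratios
    [r = z / q] average with weights [A_ij = W_ij q_j / q'_i], and [q] stays above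
    a fixed power of [nu].  Strong connectivity over windows makes the oscillation
    of [r] contract geometrically up to [O(gamma)], so it is square summable; it
    bounds the distance between every [y_i] and the mean [zb] of the [z_i].

    Let [N_p] be the size of [V p].  Since [W] preserves sums, [zb] performs a
    subgradient step with block step sizes [gamma / N_p], so
    [sum_p N_p |zb_p - x_p|^2] is a quasi-Fejer sequence for each minimizer [x],
    with decrease [2 gamma (F zb - F x)].  Divergence of [sum gamma] then yields a
    minimizing subsequence, and quasi-Fejer monotonicity applied to one of its
    cluster points gives convergence of the whole sequence.  That the [f_i] are
    Lipschitz is deduced from the existence of subgradients at every point. *)

Require Import Defs.
From HB Require Import structures.
From mathcomp Require Import all_boot all_order all_algebra.
From mathcomp Require Import all_classical all_reals all_analysis.
From mathcomp Require Import ring lra.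
Import Order.TTheory GRing.Theory Num.Theory.
Import numFieldNormedType.Exports.
Local Open Scope classical_set_scope.
Local Open Scope ring_scope.

(** * Contraction of the oscillation *)

Lemma connect_crossing (T : finType) (e : rel T) (S : {set T}) (a b : T) :
  connect e a b -> a \in S -> b \notin S ->
  exists u v, [/\ u \in S, v \notin S & e u v].
Proof.
move=> /connectP[p pth ->]; elim: p a pth => [|c p IH] a /=.
  by move=> _ ->.
move=> /andP[eac pth] aS lS; have [cS|cS] := boolP (c \in S).
  exact: IH pth cS lS.
by exists a, c.
Qed.

Section Contraction.
Variables (R : realType) (I : nat) (V : {set 'I_I}) (E : nat -> rel 'I_I) (Q : nat).
Hypothesis Q_gt0 : (0 < Q)%N.
Hypothesis E_refl : forall t i, i \in V -> E t i i.
Hypothesis E_connected : forall k, strongly_connected V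
  (fun a b => [&& a \in V, b \in V & [exists t : 'I_Q, E (k * Q + t)%N a b]]).

(** Up to [Q] steps are lost in reaching the next window boundary. Then come [I] windows, each
    adding a vertex, which is enough to exhaust [V]. *)
Let B := (I.+1 * Q)%N.

(* The set of vertices carrying at least [nu ^+ t * c] never shrinks, and gains
   a vertex in every connectivity window until it is all of [V]. *)
Lemma propagation (nu : R) (x : nat -> 'I_I -> R) (s : nat) (c : R) :
  0 <= nu ->
  (forall t i j, (s <= t)%N -> i \in V -> j \in V -> E t j i -> nu * x t j <= x t.+1 i) ->
  forall j i, j \in V -> i \in V -> c <= x s j ->
  nu ^+ B * c <= x (s + B)%N i.
Proof.
move=> nu0 xE j i jV iV cx.
pose S t := [set a in V | nu ^+ t * c <= x (s + t)%N a].
have step t a b : a \in S t -> b \in V -> E (s + t)%N a b -> b \in S t.+1.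
  rewrite !inE => /andP[aV ha] bV eab; rewrite bV /= addnS exprS -mulrA.
  apply: le_trans (xE _ _ _ (leq_addr _ _) bV aV eab).
  exact: ler_wpM2l.
have S1 t : S t \subset S t.+1.
  apply/fintype.subsetP => a aS; apply: step (aS) _ _; first by move: aS; rewrite inE => /andP[].
  by apply: E_refl; move: aS; rewrite inE => /andP[].
have SS t t' : (t <= t')%N -> S t \subset S t'.
  move=> /subnKC <-; elim: (t' - t)%N => [|d IH]; first by rewrite addn0.
  by rewrite addnS (fintype.subset_trans IH).
have SV t : S t \subset V by apply/fintype.subsetP => a; rewrite inE => /andP[].
pose m := (s %/ Q).+1.
have sm : (s <= m * Q)%N by exact: ltnW (ltn_ceil s Q_gt0).
have ms : (m * Q <= s + Q)%N by rewrite /m mulSn addnC leq_add2r leq_trunc_div.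
pose th h := ((m + h) * Q - s)%N.
have thE h : (s + th h = (m + h) * Q)%N.
  by rewrite subnKC // (leq_trans sm) // leq_mul2r leq_addr orbT.
have thD h : th h.+1 = (th h + Q)%N.
  by apply/eqP; rewrite -(eqn_add2l s) addnA !thE addnS mulSn addnC.
have grow h : (minn #|V| h.+1 <= #|S (th h)|)%N.
  elim: h => [|h IH].
    apply: (leq_trans (geq_minr _ _)); apply/card_gt0P; exists j.
    apply: (fintype.subsetP (SS 0%N _ _)) => //.
    by rewrite inE jV expr0 mul1r addn0.
  have thS : (th h <= th h.+1)%N by rewrite thD leq_addr.
  have [VS|] := boolP (V \subset S (th h)).
    apply: (leq_trans (geq_minl _ _)); apply: subset_leq_card.
    exact: fintype.subset_trans VS (SS _ _ thS).
  move=> /subsetPn[b bV bS].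
  have jS : j \in S (th h).
    apply: (fintype.subsetP (SS 0%N _ _)) => //.
    by rewrite inE jV expr0 mul1r addn0.
  have [u [v [uS vS]]] := @connect_crossing _ _ _ _ _ (E_connected (m + h)%N j b jV bV) jS bS.
  case/and3P=> uV vV /existsP[t euv].
  have vS1 : v \in S (th h.+1).
    apply: (fintype.subsetP (SS (th h + t).+1 _ _)).
      by rewrite thD ltn_add2l.
    apply: step (fintype.subsetP (SS _ _ (leq_addr _ _)) _ uS) vV _.
    by rewrite addnA thE.
  have : (#|S (th h)| < #|S (th h.+1)|)%N.
    apply: proper_card; apply/properP; split; first exact: SS.
    by exists v.
  apply: leq_trans; apply: leq_trans (_ : (minn #|V| h.+1).+1 <= _)%N; last by rewrite ltnS.
  by rewrite -minnSS leq_min !geq_min leqnn leqnSn orbT.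
have full : V \subset S B.
  apply: fintype.subset_trans (SS (th I) B _); last first.
    by rewrite -(leq_add2l s) thE mulnDl /B mulSn addnA leq_add2r.
  rewrite -(geq_leqif (subset_leqif_card (SV _))).
  apply: leq_trans (grow I); rewrite leq_min leqnn /= leqW //.
  by rewrite -[leqRHS]card_ord max_card.
by have := fintype.subsetP full _ iV; rewrite inE => /andP[].
Qed.

(** Maximum minus minimum over [V]. For nonempty [V] the diagonal pairs already give 0, so the
    default value matters only when [V] is empty. *)
Definition osc (r : 'I_I -> R) : R :=
  \big[Num.max/0]_(ij : 'I_I * 'I_I | (ij.1 \in V) && (ij.2 \in V)) (r ij.1 - r ij.2).

Lemma osc_ge0 r : 0 <= osc r.
Proof. exact: bigmax_ge_id. Qed.

Lemma ler_osc r i j : i \in V -> j \in V -> r i - r j <= osc r.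
Proof.
move=> iV jV.
by apply: (@le_bigmax_cond _ _ _ 0 (i, j) _ (fun ij => r ij.1 - r ij.2)); rewrite /= iV.
Qed.

Lemma osc_ler r D : 0 <= D ->
  (forall i j, i \in V -> j \in V -> r i - r j <= D) -> osc r <= D.
Proof. by move=> D0 rD; apply: bigmax_le => // -[i j] /= /andP[]; exact: rD. Qed.

(** As both weight families sum to 1, the difference is the double average of [r i - r j] with
    weights [u i * v j]. *)
Lemma average_sub_le_osc (r u v : 'I_I -> R) :
  (forall i, i \in V -> 0 <= u i) -> \sum_(i in V) u i = 1 ->
  (forall i, i \in V -> 0 <= v i) -> \sum_(i in V) v i = 1 ->
  \sum_(i in V) u i * r i - \sum_(i in V) v i * r i <= osc r.
Proof.
move=> u0 u1 v0 v1.
have -> : \sum_(i in V) u i * r i - \sum_(i in V) v i * r i =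
    \sum_(i in V) \sum_(j in V) u i * v j * (r i - r j).
  rewrite -[X in X - _]mulr1 -[X in _ - X]mul1r -{1}v1 -u1 !big_distrl -sumrB /=.
  apply: eq_bigr => i _; rewrite !big_distrr /= -sumrB.
  by apply: eq_bigr => j _; ring.
rewrite -[leRHS]mul1r -u1 big_distrl /=; apply: ler_sum => i iV.
rewrite -[leRHS]mulr1 -v1 big_distrr /=; apply: ler_sum => j jV.
rewrite mulrAC; apply: ler_wpM2r; first exact: v0.
by apply: ler_wpM2l; [exact: u0|exact: ler_osc].
Qed.

Variables (A : nat -> 'I_I -> 'I_I -> R) (al : R) (r : nat -> 'I_I -> R) (b : nat -> R).
Hypothesis al_gt0 : 0 < al.
Hypothesis A_ge0 : forall t i j, i \in V -> j \in V -> 0 <= A t i j.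
Hypothesis A_row : forall t i, i \in V -> \sum_(j in V) A t i j = 1.
Hypothesis A_edge : forall t i j, i \in V -> j \in V -> E t j i -> al <= A t i j.
Hypothesis b_ge0 : forall t, 0 <= b t.
Hypothesis b_mono : forall t, b t.+1 <= b t.
Hypothesis r_step : forall t i, i \in V ->
  `|r t.+1 i - \sum_(j in V) A t i j * r t j| <= b t.

(** The maximiser at time [s] lifts every entry above the old minimum by a fraction [al ^+ B] of the
    initial spread, while averaging alone never raises the maximum. The perturbations cost at most
    [B%:R * b s] on each side because [b] is non-increasing. *)
Lemma osc_contraction (i0 : 'I_I) (s : nat) : i0 \in V ->
  osc (r (s + B)%N) <= (1 - al ^+ B) * osc (r s) + 2 * (B%:R * b s).
Proof.
move=> i0V.
have al1 : al <= 1.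
  rewrite -(A_row 0 i0) //; apply: le_trans (A_edge _ _ _ i0V i0V (E_refl 0 _ i0V)) _.
  rewrite (bigD1 i0) //= lerDl; apply: sumr_ge0 => j /andP[jV _]; exact: A_ge0.
have alB : 0 <= al ^+ B <= 1 by rewrite exprn_ge0 ?exprn_ile1 // ltW.
have [iM iMV hM] := @arg_maxP _ _ _ i0 (mem V) (r s) i0V.
have [im imV hm] := @arg_minP _ _ _ i0 (mem V) (r s) i0V.
have bs d : b (s + d)%N <= b s.
  by elim: d => [|d IH]; rewrite ?addn0 // addnS (le_trans (b_mono _)).
have lo i d : i \in V -> r s im - d%:R * b s <= r (s + d)%N i.
  elim: d i => [|d IH] i iV; first by rewrite mul0r subr0 addn0; exact: hm.
  rewrite addnS.
  have := r_step (s + d)%N _ iV; rewrite ler_norml => /andP[h1 _].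
  have h2 : r s im - d%:R * b s <= \sum_(j in V) A (s + d)%N i j * r (s + d)%N j.
    rewrite -[leLHS]mul1r -[X in X * _](A_row (s + d)%N i iV) big_distrl /=.
    by apply: ler_sum => j jV; apply: ler_wpM2l; [exact: A_ge0|exact: IH].
  have := bs d; rewrite -natr1 mulrDl mul1r; lra.
have hi i d : i \in V -> r (s + d)%N i <= r s iM + d%:R * b s.
  elim: d i => [|d IH] i iV; first by rewrite mul0r addr0 addn0; exact: hM.
  rewrite addnS.
  have := r_step (s + d)%N _ iV; rewrite ler_norml => /andP[_ h1].
  have h2 : \sum_(j in V) A (s + d)%N i j * r (s + d)%N j <= r s iM + d%:R * b s.
    rewrite -[leRHS]mul1r -[X in X * _](A_row (s + d)%N i iV) big_distrl /=.
    by apply: ler_sum => j jV; apply: ler_wpM2l; [exact: A_ge0|exact: IH].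
  have := bs d; rewrite -natr1 mulrDl mul1r; lra.
(* Adding back the accumulated perturbation makes [x] nonnegative and
   superharmonic, so that [propagation] applies to it. *)
pose x t i := r t i - r s im + (t - s)%:R * b s.
have x_edge t i j : (s <= t)%N -> i \in V -> j \in V -> E t j i -> al * x t j <= x t.+1 i.
  move=> /subnKC <-; move: (t - s)%N => d iV jV eji.
  have x0 k : k \in V -> 0 <= x (s + d)%N k.
    by move=> kV; rewrite /x addKn; have := lo k d kV; lra.
  have : \sum_(k in V) A (s + d)%N i k * x (s + d)%N k <= x (s + d).+1 i.
    have -> : \sum_(k in V) A (s + d)%N i k * x (s + d)%N k =
        \sum_(k in V) A (s + d)%N i k * r (s + d)%N k - r s im + d%:R * b s.
      rewrite -addrA -[X in _ + X]mul1r -[X in _ + X * _](A_row (s + d)%N i iV).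
      rewrite big_distrl /= -big_split /=.
      by apply: eq_bigr => k _; rewrite /x addKn; ring.
    rewrite /x -addnS addKn -natr1 mulrDl mul1r addnS.
    have := r_step (s + d)%N _ iV; rewrite ler_norml => /andP[h1 _].
    have := bs d; lra.
  apply: le_trans; rewrite (bigD1 j) //=.
  apply: le_trans (_ : A (s + d)%N i j * x (s + d)%N j <= _).
    by apply: ler_wpM2r; [exact: x0|rewrite A_edge // ].
  by rewrite lerDl; apply: sumr_ge0 => k /andP[kV _]; rewrite mulr_ge0 ?A_ge0 ?x0.
have low i : i \in V ->
    r s im + al ^+ B * (r s iM - r s im) - B%:R * b s <= r (s + B)%N i.
  move=> iV.
  have := propagation _ _ s (r s iM - r s im) (ltW al_gt0) x_edge _ _ iMV iV.
  rewrite /x subnn mul0r addr0 => /(_ (lexx _)); rewrite addKn; lra.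
have Mm := ler_osc (r s) _ _ iMV imV.
have o0 := osc_ge0 (r s).
have bB : 0 <= B%:R * b s by rewrite mulr_ge0.
apply: osc_ler; first by nra.
move=> i j iV jV; have := low j jV; have := hi i B iV; nra.
Qed.

End Contraction.

Arguments osc {R I} V r.

(** * Push-sum consensus *)

(** Convexity of the square gives [(rho * D + c) ^+ 2 <= rho * D ^+ 2 + c ^+ 2 / (1 - rho)]. After
    summation the term with factor [rho] is absorbed on the left, leaving the first [B] squares and
    [G]. *)
Lemma sum_sqr_bounded_contraction (R : realType) (D c : nat -> R) (B : nat) (rho G : R) :
  0 <= rho < 1 -> (forall k, 0 <= D k) ->
  (forall k, D (k + B)%N <= rho * D k + c k) ->
  (forall n, \sum_(k < n) c k ^+ 2 <= G) ->
  exists K, forall n, \sum_(k < n) D k ^+ 2 <= K.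
Proof.
move=> /andP[rho0 rho1] D0 DB cG; have s0 : 0 < 1 - rho by rewrite subr_gt0.
have step k : (1 - rho) * D (k + B)%N ^+ 2 <= (1 - rho) * rho * D k ^+ 2 + c k ^+ 2.
  have h : D (k + B)%N ^+ 2 <= (rho * D k + c k) ^+ 2.
    by rewrite lerXn2r ?nnegrE //; apply: le_trans (DB k).
  apply: le_trans (ler_wpM2l (ltW s0) h) _; rewrite -subr_ge0.
  have -> : (1 - rho) * rho * D k ^+ 2 + c k ^+ 2 - (1 - rho) * (rho * D k + c k) ^+ 2 =
     rho * ((1 - rho) * D k - c k) ^+ 2 by ring.
  by rewrite mulr_ge0 ?sqr_ge0.
exists (((1 - rho) * \sum_(k < B) D k ^+ 2 + G) / (1 - rho) ^+ 2) => n.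
rewrite ler_pdivlMr ?exprn_gt0 //.
have S1 : \sum_(k < n) D k ^+ 2 <= \sum_(k < B) D k ^+ 2 + \sum_(k < n) D (k + B)%N ^+ 2.
  have -> : \sum_(k < B) D k ^+ 2 + \sum_(k < n) D (k + B)%N ^+ 2 = \sum_(k < n + B) D k ^+ 2.
    rewrite addnC big_split_ord /=; congr (_ + _).
    by apply: eq_bigr => k _; rewrite addnC.
  rewrite big_split_ord /= lerDl; apply: sumr_ge0 => k _; exact: sqr_ge0.
have S2 : (1 - rho) * \sum_(k < n) D (k + B)%N ^+ 2 <=
    (1 - rho) * rho * \sum_(k < n) D k ^+ 2 + G.
  apply: le_trans (_ : _ <= (1 - rho) * rho * \sum_(k < n) D k ^+ 2 + \sum_(k < n) c k ^+ 2) _.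
    by rewrite !big_distrr -big_split /=; apply: ler_sum => k _; exact: step.
  by rewrite lerD2l.
by have := ler_wpM2l (ltW s0) S1; lra.
Qed.

Section PushSum.
Variables (R : realType) (I : nat) (V : {set 'I_I}) (W : nat -> 'I_I -> 'I_I -> R).
Variables (nu : R) (Q : nat) (q z w y e : nat -> 'I_I -> R) (b : nat -> R).
Hypothesis W_ge0 : forall k i j, i \in V -> j \in V -> 0 <= W k i j.
Hypothesis W_diag : forall k i, i \in V -> 0 < W k i i.
Hypothesis W_col : forall k j, j \in V -> \sum_(i in V) W k i j = 1.
Hypothesis nu_gt0 : 0 < nu.
Hypothesis W_edge : forall k i j, i \in V -> j \in V -> 0 < W k i j -> nu <= W k i j.
Hypothesis Q_gt0 : (0 < Q)%N.
Hypothesis W_connected : forall k, strongly_connected V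
  (fun a b => [&& a \in V, b \in V & [exists t : 'I_Q, 0 < W (k * Q + t)%N b a]]).
Hypothesis q_init : forall i, i \in V -> q 0%N i = 1.
Hypothesis q_step : forall k i, i \in V -> q k.+1 i = \sum_(j in V) W k i j * q k j.
Hypothesis w_step : forall k i, i \in V -> w k.+1 i = \sum_(j in V) W k i j * z k j.
Hypothesis y_step : forall k i, i \in V -> y k.+1 i = w k.+1 i / q k.+1 i.
Hypothesis z_step : forall k i, i \in V -> z k.+1 i = w k.+1 i - e k i.
Hypothesis e_le : forall k i, i \in V -> `|e k i| <= b k.
Hypothesis b_mono : forall k, b k.+1 <= b k.

Let B := (I.+1 * Q)%N.

Lemma nu_le1 i : i \in V -> nu <= 1.
Proof.
move=> iV; rewrite -(W_col 0 i iV) (bigD1 i) //=.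
apply: le_trans (W_edge 0 _ _ iV iV (W_diag 0 _ iV)) _.
by rewrite lerDl; apply: sumr_ge0 => j /andP[jV _]; exact: W_ge0.
Qed.

Lemma q_gt0 k i : i \in V -> 0 < q k i.
Proof.
elim: k i => [|k IH] i iV; first by rewrite q_init.
rewrite q_step // (bigD1 i) //= ltr_wpDr ?mulr_gt0 ?W_diag ?IH //.
by apply: sumr_ge0 => j /andP[jV _]; rewrite mulr_ge0 ?W_ge0 // ltW ?IH.
Qed.

Lemma sum_column_stochastic k (x : 'I_I -> R) :
  \sum_(i in V) \sum_(j in V) W k i j * x j = \sum_(j in V) x j.
Proof.
rewrite exchange_big /=; apply: eq_bigr => j jV.
by rewrite -big_distrl /= W_col // mul1r.
Qed.

Lemma sum_q k : \sum_(i in V) q k i = #|V|%:R.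
Proof.
elim: k => [|k IH].
  by rewrite -sum1_card natr_sum; apply: eq_bigr => i iV; rewrite q_init.
rewrite -IH -[RHS](sum_column_stochastic k); apply: eq_bigr => i iV; exact: q_step.
Qed.

Lemma q_le_card k i : i \in V -> q k i <= #|V|%:R.
Proof.
move=> iV; rewrite -(sum_q k) (bigD1 i) //= lerDl.
by apply: sumr_ge0 => j /andP[jV _]; rewrite ltW ?q_gt0.
Qed.

Lemma q_edge k i j : i \in V -> j \in V -> 0 < W k i j -> nu * q k j <= q k.+1 i.
Proof.
move=> iV jV Wij; rewrite q_step // (bigD1 j) //=.
apply: le_trans (_ : W k i j * q k j <= _).
  by apply: ler_wpM2r; [rewrite ltW ?q_gt0 | exact: W_edge].
by rewrite lerDl; apply: sumr_ge0 => l /andP[lV _]; rewrite mulr_ge0 ?W_ge0 // ltW ?q_gt0.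
Qed.

(** Up to time [B] the self-loops alone suffice. Later, the [q] sum to [#|V|], so some vertex has
    weight at least 1 at time [k - B], and [propagation] carries it to every vertex with loss
    [nu ^+ B]. *)
Lemma q_ge k i : i \in V -> nu ^+ B <= q k i.
Proof.
move=> iV; have nu1 := nu_le1 _ iV; have nu0 := ltW nu_gt0.
have [kB|Bk] := leqP k B.
  apply: le_trans (_ : nu ^+ k <= _); first exact: ler_wiXn2l.
  elim: k {kB} => [|k IH]; first by rewrite q_init.
  rewrite exprS; apply: le_trans (q_edge k _ _ iV iV (W_diag k _ iV)).
  exact: ler_wpM2l.
have [j jV qj] : exists2 j, j \in V & 1 <= q (k - B)%N j.
  apply/exists_inP; apply: contraT; rewrite negb_exists_in => /forall_inP h.
  have : \sum_(j in V) q (k - B)%N j < \sum_(j in V) 1.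
    by apply: ltr_sum => [|j jV]; [apply/hasP; exists i; rewrite ?mem_index_enum | rewrite ltNge h].
  by rewrite sum_q -sumr_const ltxx.
have := @propagation R I V (fun t a b => 0 < W t b a) Q Q_gt0 W_diag W_connected nu q
  (k - B)%N 1 nu0 (fun t i j _ => q_edge t i j) j i jV iV qj.
by rewrite mulr1 subnK // ltnW.
Qed.

Let A k i j := W k i j * q k j / q k.+1 i.
Let r k i := z k i / q k i.

Lemma A_row k i : i \in V -> \sum_(j in V) A k i j = 1.
Proof. by move=> iV; rewrite -big_distrl /= -q_step // divff // gt_eqF ?q_gt0. Qed.

Lemma A_ge0 k i j : i \in V -> j \in V -> 0 <= A k i j.
Proof. by move=> iV jV; rewrite !mulr_ge0 ?W_ge0 ?invr_ge0 // ltW ?q_gt0. Qed.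

Lemma y_average k i : i \in V -> y k.+1 i = \sum_(j in V) A k i j * r k j.
Proof.
move=> iV; rewrite y_step // w_step // big_distrl /=; apply: eq_bigr => j jV.
have qj : q k j != 0 by rewrite gt_eqF ?q_gt0.
by rewrite /A /r; field; rewrite qj gt_eqF ?q_gt0.
Qed.

Lemma zbar_average k i0 : i0 \in V ->
  (\sum_(i in V) z k i) / #|V|%:R = \sum_(i in V) (q k i / #|V|%:R) * r k i.
Proof.
move=> i0V; rewrite big_distrl /=; apply: eq_bigr => i iV.
have qj : q k i != 0 by rewrite gt_eqF ?q_gt0.
have V0 : #|V|%:R != 0 :> R by rewrite pnatr_eq0 -lt0n; apply/card_gt0P; exists i0.
by rewrite /r; field; rewrite qj.
Qed.

(* The ratios [z / q] follow a perturbed row-stochastic averaging, of which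
   both [y] and the mean of [z] are convex combinations. *)
Lemma push_sum_consensus (G : R) : (forall n, \sum_(k < n) b k ^+ 2 <= G) ->
  exists E : nat -> R, [/\ forall k, 0 <= E k,
    exists K, forall n, \sum_(k < n) E k ^+ 2 <= K &
    forall k i, i \in V -> `|y k.+1 i - (\sum_(j in V) z k j) / #|V|%:R| <= E k].
Proof.
move=> bG; have [V0|[i0 i0V]] := set_0Vmem V.
  exists (fun=> 0); split => //; last by move=> k i; rewrite V0 inE.
  by exists 0 => n; rewrite big1 // => k _; rewrite expr0n.
exists (fun k => osc V (r k)); split => [k||k i iV]; first exact: osc_ge0.
- have nu1 := nu_le1 _ i0V.
  have V0 : 0 < #|V|%:R :> R by rewrite ltr0n; apply/card_gt0P; exists i0.
  pose de := nu ^+ B.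
  have de0 : 0 < de by rewrite exprn_gt0.
  (* A positive [W] is at least [nu], [q k j] is at least [de], and the denominator [q k.+1 i] is at
     most [#|V|]. *)
  pose al := nu * de / #|V|%:R.
  have al0 : 0 < al by rewrite !mulr_gt0 ?invr_gt0.
  have b0 t : 0 <= b t by apply: le_trans (e_le t i0 i0V); exact: normr_ge0.
  have A_edge t i j : i \in V -> j \in V -> 0 < W t i j -> al <= A t i j.
    move=> iV jV Wij; rewrite /al /A.
    rewrite ler_pM ?mulr_ge0 ?invr_ge0 ?(ltW de0) ?(ltW nu_gt0) ?(ltW V0) //.
      by rewrite ler_pM ?(ltW de0) ?(ltW nu_gt0) ?W_edge //; exact: q_ge.
    by rewrite lef_pV2 ?posrE ?q_gt0 // q_le_card.
  have al1 : al <= 1.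
    rewrite -(A_row 0 i0) //; apply: le_trans (A_edge 0 _ _ i0V i0V (W_diag 0 _ i0V)) _.
    rewrite (bigD1 i0) //= lerDl; apply: sumr_ge0 => j /andP[jV _]; exact: A_ge0.
  have r_step t i : i \in V -> `|r t.+1 i - \sum_(j in V) A t i j * r t j| <= b t / de.
    move=> iV; rewrite -y_average // y_step // /r z_step // -mulrBl addrAC subrr add0r.
    rewrite normrM normrN normfV [`|q _ _|]gtr0_norm ?q_gt0 //.
    rewrite ler_pM ?invr_ge0 ?e_le // ?(ltW (q_gt0 _ _ _)) //.
    by rewrite lef_pV2 ?posrE ?q_gt0 // q_ge.
  apply: (@sum_sqr_bounded_contraction R (fun k => osc V (r k))
    (fun k => 2 * (B%:R * (b k / de))) B (1 - al ^+ B) ((2 * B%:R / de) ^+ 2 * G)) => //.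
  + rewrite subr_ge0 exprn_ile1 ?(ltW al0) //= ltrBlDr ltrDl exprn_gt0 //.
  + by move=> k; exact: osc_ge0.
  + move=> k; apply: (@osc_contraction R I V (fun t a b => 0 < W t b a) Q Q_gt0 W_diag
      W_connected A al r (fun k => b k / de) al0 A_ge0 A_row A_edge _ _ r_step i0 k i0V).
      by move=> t; rewrite divr_ge0 // ltW.
    by move=> t; rewrite ler_pM2r ?invr_gt0.
  + move=> n; rewrite [leLHS](_ : _ = (2 * B%:R / de) ^+ 2 * \sum_(k < n) b k ^+ 2).
      by rewrite ler_wpM2l ?sqr_ge0.
    by rewrite big_distrr /=; apply: eq_bigr => k _; ring.
have q0 j : j \in V -> 0 <= q k j / #|V|%:R by move=> jV; rewrite divr_ge0 // ltW ?q_gt0.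
have q1 : \sum_(j in V) q k j / #|V|%:R = 1.
  by rewrite -big_distrl /= sum_q divff // pnatr_eq0 -lt0n; apply/card_gt0P; exists i.
rewrite (zbar_average k i0) // y_average // ler_norml; apply/andP; split.
  by rewrite lerNl opprB; apply: average_sub_le_osc => // [j jV|]; [exact: A_ge0|exact: A_row].
by apply: average_sub_le_osc => // [j jV|]; [exact: A_ge0|exact: A_row].
Qed.

End PushSum.

(** * Existence of subgradients *)

Section Subgradient.
Variables (R : realType) (T : finType).
Implicit Types (f : (T -> R) -> R) (x z : T -> R).

Definition convex_coords f := forall x z t, 0 <= t -> t <= 1 ->
  f (fun i => t * x i + (1 - t) * z i) <= t * f x + (1 - t) * f z.

Definition upd x (i : T) (a : R) : T -> R := fun j => if j == i then a else x j.

Lemma upd_id x i : upd x i (x i) = x.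
Proof. by apply: funext => j; rewrite /upd; case: eqP => // ->. Qed.

(** By [conv], no left difference quotient at [x i] exceeds a right one. The infimum of the right
    quotients therefore serves as slope on both sides. *)
Lemma convex_partial_slope f x i : convex_coords f ->
  exists a, forall s, f x + a * (s - x i) <= f (upd x i s).
Proof.
move=> cf; pose phi s := f (upd x i s).
have fx : f x = phi (x i) by rewrite /phi upd_id.
have conv s u : 0 < s -> 0 < u ->
    (s + u) * phi (x i) <= u * phi (x i + s) + s * phi (x i - u).
  move=> s0 u0; have su : 0 < s + u by rewrite addr_gt0.
  have t0 : 0 <= u / (s + u) by rewrite divr_ge0 ?ltW.
  have t1 : u / (s + u) <= 1 by rewrite ler_pdivrMr // mul1r lerDr ltW.
  have := cf (upd x i (x i + s)) (upd x i (x i - u)) _ t0 t1.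
  have -> : (fun j => u / (s + u) * upd x i (x i + s) j +
      (1 - u / (s + u)) * upd x i (x i - u) j) = upd x i (x i).
    by apply: funext => j; rewrite /upd; case: eqP => _; field; exact: lt0r_neq0.
  rewrite -/(phi _) -/(phi (x i + s)) -/(phi (x i - u)) -(ler_pM2l su).
  congr (_ <= _); field; exact: lt0r_neq0.
pose S := [set (phi (x i + s) - phi (x i)) / s | s in [set s | 0 < s]].
have lbS u : 0 < u -> lbound S ((phi (x i) - phi (x i - u)) / u).
  move=> u0 _ /= [s s0 <-]; rewrite ler_pdivrMr // mulrAC ler_pdivlMr //.
  by have := conv s u s0 u0; lra.
exists (inf S) => s; rewrite fx -/(phi s).
have [sx|sx|->] := ltgtP s (x i); last by rewrite subrr mulr0 addr0.
  have u0 : 0 < x i - s by rewrite subr_gt0.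
  have : (phi (x i) - phi s) / (x i - s) <= inf S.
    apply: lb_le_inf; first by exists ((phi (x i + 1) - phi (x i)) / 1), 1 => //=.
    by have := lbS _ u0; rewrite subKr.
  by rewrite ler_pdivrMr //; lra.
have u0 : 0 < s - x i by rewrite subr_gt0.
have : inf S <= (phi s - phi (x i)) / (s - x i).
  apply: ge_inf; first by exists ((phi (x i) - phi (x i - 1)) / 1); apply: lbS.
  by exists (s - x i) => //=; rewrite [x i + _]addrC subrK.
by rewrite ler_pdivlMr //; lra.
Qed.

(** Subtract the supporting slope in coordinate [i], then minimise over that coordinate: the result
    is convex, free of coordinate [i], and keeps its value at [x]. The last clause preserves
    eliminations made earlier. *)
Lemma convex_eliminate f x i : convex_coords f ->
  exists (a : R) (h : (T -> R) -> R), [/\ convex_coords h, h x = f x,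
    forall z, h z + a * (z i - x i) <= f z,
    forall z s, h (upd z i s) = h z &
    forall j, (forall z s, f (upd z j s) = f z) -> forall z s, h (upd z j s) = h z].
Proof.
move=> cf; have [a ha] := convex_partial_slope f x i cf.
pose S z := [set f (upd z i s) - a * (s - x i) | s in [set: R]].
have S0 z : S z !=set0 by exists (f (upd z i 0) - a * (0 - x i)), 0.
(* The lower bound comes from comparing [z] with its reflection through [x]. *)
have lbS z : has_lbound (S z).
  pose z' j := 2 * x j - z j.
  exists (2 * f x + a * (z' i - x i) - f z') => _ /= [s _ <-].
  have h0 : (0 : R) <= 1 / 2 by rewrite divr_ge0.
  have h1 : 1 / 2 <= (1 : R) by rewrite ler_pdivrMr // mul1r; exact: (ler_nat R 1 2).
  have := cf (upd z i s) z' _ h0 h1.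
  have -> : (fun j => 1 / 2 * upd z i s j + (1 - 1 / 2) * z' j) =
      upd x i (1 / 2 * s + 1 / 2 * z' i).
    by apply: funext => j; rewrite /upd /z'; case: eqP => [->|_]; field.
  have := ha (1 / 2 * s + 1 / 2 * z' i); lra.
pose h z := inf (S z).
have h_le z s : h z <= f (upd z i s) - a * (s - x i) by apply: ge_inf => //; exists s.
have h_ge z c : (forall s, c <= f (upd z i s) - a * (s - x i)) -> c <= h z.
  by move=> hc; apply: lb_le_inf => // _ [s _ <-].
exists a, h; split.
(* The convex combination of near-minimisers for [u] and [v] is a competitor in the infimum at the
   combined point. *)
- move=> u v t t0 t1; apply/ler_addgt0Pr => e e0.
  have [_ [su _ <-] hu] := inf_adherent e0 (conj (S0 u) (lbS u)).
  have [_ [sv _ <-] hv] := inf_adherent e0 (conj (S0 v) (lbS v)).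
  apply: (le_trans (h_le _ (t * su + (1 - t) * sv))).
  have := cf (upd u i su) (upd v i sv) t t0 t1.
  have -> : (fun j => t * upd u i su j + (1 - t) * upd v i sv j) =
      upd (fun j => t * u j + (1 - t) * v j) i (t * su + (1 - t) * sv).
    by apply: funext => j; rewrite /upd; case: eqP.
  have t1' : 0 <= 1 - t by rewrite subr_ge0.
  have := ler_wpM2l t0 (ltW hu); have := ler_wpM2l t1' (ltW hv); rewrite -/(h u) -/(h v); lra.
- apply/eqP; rewrite eq_le; apply/andP; split.
    by have := h_le x (x i); rewrite upd_id subrr mulr0 subr0.
  by apply: h_ge => s; have := ha s; lra.
- by move=> z; have := h_le z (z i); rewrite upd_id; lra.
- move=> z s; rewrite /h /S; congr inf; apply: eq_imagel => u _.
  by congr (f _ - _); apply: funext => j; rewrite /upd; case: eqP.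
- move=> j fj z s; have [->|ji] := eqVneq j i.
    rewrite /h /S; congr inf; apply: eq_imagel => u _.
    by congr (f _ - _); apply: funext => k; rewrite /upd; case: eqP.
  rewrite /h /S; congr inf; apply: eq_imagel => u _; congr (_ - _).
  rewrite -(fj (upd z i u) s); congr f; apply: funext => k; rewrite /upd.
  by case: (eqVneq k i) => [->|]; rewrite ?[i == j]eq_sym ?(negbTE ji).
Qed.

(** Eliminating all coordinates in turn leaves a constant function of value [f x]; the slopes
    collected on the way form the subgradient. *)
Lemma subgradient_exists f x : convex_coords f ->
  exists g : T -> R, forall z, f x + \sum_i g i * (z i - x i) <= f z.
Proof.
move=> cf.
have H (s : seq T) : uniq s -> exists (g : T -> R) (h : (T -> R) -> R),
    [/\ convex_coords h, h x = f x,
        forall z, h z + \sum_(i <- s) g i * (z i - x i) <= f z &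
        forall j, j \in s -> forall z s, h (upd z j s) = h z].
  elim: s => [_|i s IH /= /andP[is_ us]].
    by exists (fun=> 0), f; split => // z; rewrite big_nil addr0.
  have [g [h [ch hx hf hs]]] := IH us.
  have [a [k [ck kx kh ki ks]]] := convex_eliminate h x i ch.
  exists (upd g i a), k; split => //; first by rewrite kx.
    move=> z; rewrite big_cons {1}/upd eqxx.
    have -> : \sum_(j <- s) upd g i a j * (z j - x j) = \sum_(j <- s) g j * (z j - x j).
      apply: eq_big_seq => j js; rewrite /upd; case: eqP => // ji.
      by rewrite ji (negbTE is_) in js.
    have := kh z; have := hf z; lra.
  move=> j; rewrite inE => /predU1P[->//|js]; exact: ks (hs j js).
have [g [h [_ hx hf hs]]] := H _ (enum_uniq T).
exists g => z; apply: le_trans (hf z); rewrite big_enum /= lerD2r -hx.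
(* Coordinates of [x] are replaced one at a time; for [s] all of [T] this shows that [h] is
   constant. *)
have Hz (s : seq T) u : h (fun j => if j \in s then u j else x j) = h x.
  elim: s => // i s IH; rewrite -IH -[RHS](hs i (mem_enum _ _) _ (u i)).
  by congr h; apply: funext => j; rewrite /upd inE; case: eqP => // ->.
rewrite -(Hz (enum T) z); apply/eqP/eqP; rewrite le_eqVlt; apply/orP; left; apply/eqP.
by congr h; apply: funext => j; rewrite mem_enum.
Qed.

End Subgradient.

(** * Compactness and quasi-Fejer sequences *)

(** Along an ultrafilter finer than [\oo] every bounded coordinate converges, so one filter handles
    all of the finitely many coordinates without successive subsequences. *)
Lemma bounded_cluster_point (R : realType) (T : finType) (u : nat -> T -> R) (M : R) :
  (forall n c, `|u n c| <= M) ->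
  exists a : T -> R, forall e K, 0 < e ->
    exists2 n, (K <= n)%N & forall c, `|u n c - a c| < e.
Proof.
move=> uM; have [U [UU oU]] := @ultraFilterLemma nat \oo _.
have PU : ProperFilter U := ultra_proper.
have H c : exists a, forall e, 0 < e -> U [set n | `|u n c - a| < e].
  have UM : ((u^~ c) @ U) `[- M, M]%classic.
    by apply: (@filterE _ U) => n /=; rewrite in_itv /= -ler_norml; exact: uM.
  have [a [_ ca]] := segment_compact _ UM.
  (* Otherwise the complement would belong to [U], and [a] could not be a cluster point. *)
  exists a => e e0; have [//|nU] := in_ultra_setVsetC [set n | `|u n c - a| < e] UU.
  have [y [/= ye ya]] := ca [set y | ~ (`|y - a| < e)] _ nU (nbhsx_ballx a e e0).
  by exfalso; apply: ye; rewrite distrC.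
have [a ha] := choice H; exists a => e K e0.
have Uall : U (fun n => forall c, `|u n c - a c| < e).
  by apply: filter_forall => c; exact: ha.
have UK : U [set n | (K <= n)%N] by apply: oU; exact: nbhs_infty_ge.
by have [n [/= nK na]] := filter_ex (filterI UK Uall); exists n.
Qed.

Section Sequences.
Variable R : realType.
Implicit Types (c D u gamma : nat -> R).

Lemma sum_bounded_tail c K : (forall k, 0 <= c k) -> (forall n, \sum_(k < n) c k <= K) ->
  forall e, 0 < e -> exists N, forall n d, (N <= n)%N -> \sum_(k < d) c (n + k)%N <= e.
Proof.
move=> c0 cK e e0; pose S := range (fun n => \sum_(k < n) c k).
have S0 : S !=set0 by exists (\sum_(k < 0) c k), 0%N.
have Sub : has_ubound S by exists K => _ [n _ <-].
have [_ [N _ <-] SN] := sup_adherent e0 (conj S0 Sub).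
exists N => n d /subnKC Nn.
have : \sum_(k < n + d) c k <= sup S by apply: ub_le_sup => //; exists (n + d)%N.
rewrite big_split_ord /=.
have : \sum_(k < N) c k <= \sum_(k < n) c k.
  by rewrite -Nn big_split_ord /= lerDl; apply: sumr_ge0.
lra.
Qed.

Lemma sum_bounded_small c K : (forall k, 0 <= c k) -> (forall n, \sum_(k < n) c k <= K) ->
  forall e, 0 < e -> exists N, forall n, (N <= n)%N -> c n <= e.
Proof.
move=> c0 cK e e0; have [N hN] := sum_bounded_tail c K c0 cK e e0.
by exists N => n /hN - /(_ 1%N); rewrite big_ord1 addn0.
Qed.

(** Once [D] falls below [e / 2] at an index where the tail of [c] is at most [e / 2], it can never
    exceed [e] again. *)
Lemma quasi_fejer D c K : (forall k, 0 <= c k) -> (forall n, \sum_(k < n) c k <= K) ->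
  (forall k, D k.+1 <= D k + c k) ->
  (forall e N, 0 < e -> exists2 k, (N <= k)%N & D k < e) ->
  forall e, 0 < e -> exists N, forall n, (N <= n)%N -> D n <= e.
Proof.
move=> c0 cK Dc Dinf e e0; have e20 : 0 < e / 2 by rewrite divr_gt0.
have [N hN] := sum_bounded_tail c K c0 cK _ e20.
have [k Nk Dk] := Dinf _ N e20; exists k => n /subnKC <-.
have : D (k + (n - k))%N <= D k + \sum_(j < n - k) c (k + j)%N.
  elim: (n - k)%N => [|d IH]; first by rewrite addn0 big_ord0 addr0.
  by rewrite addnS big_ord_recr /= addrA; apply: le_trans (Dc _) _; rewrite lerD2r.
have := hN k (n - k)%N Nk; lra.
Qed.

(** If [u] stayed above [e] from [N] on, a stretch of [gamma] of total at least [(K + 1) / e] would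
    push the weighted sum past [K]. *)
Lemma weighted_liminf gamma u K : (forall k, 0 < gamma k) -> (forall k, 0 <= u k) ->
  (forall A, exists N, forall n, (N <= n)%N -> A <= \sum_(k < n) gamma k) ->
  (forall n, \sum_(k < n) gamma k * u k <= K) ->
  forall e N, 0 < e -> exists2 n, (N <= n)%N & u n < e.
Proof.
move=> gamma0 u0 div guK e N e0; apply: contrapT => nex.
have ue n : (N <= n)%N -> e <= u n.
  by move=> Nn; rewrite leNgt; apply/negP => un; apply: nex; exists n.
have [N' hN'] := div ((K + 1) / e + \sum_(k < N) gamma k).
have : (K + 1) / e <= \sum_(k < N') gamma (N + k)%N.
  by have := hN' (N + N')%N (leq_addl _ _); rewrite big_split_ord /=; lra.
rewrite ler_pdivrMr //.
have : \sum_(k < N') gamma (N + k)%N * e <= \sum_(k < N + N') gamma k * u k.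
  rewrite big_split_ord /=.
  apply: le_trans (_ : _ <= \sum_(k < N') gamma (N + k)%N * u (N + k)%N) _.
    by apply: ler_sum => k _; apply: ler_wpM2l; [exact: ltW|exact/ue/leq_addr].
  by rewrite lerDr; apply: sumr_ge0 => k _; rewrite mulr_ge0 // ltW.
by rewrite -big_distrl /=; have := guK (N + N')%N; lra.
Qed.

(** The bound [d <= 1] allows squares of quantities at most [d] to be bounded by [d]. *)
Lemma small_multiplier (C e : R) : 0 <= C -> 0 < e -> exists d, [/\ 0 < d, d <= 1 & C * d < e].
Proof.
move=> C0 e0; have D0 : 0 < C + 1 + e by lra.
exists (e / (C + 1 + e)); split; first exact: divr_gt0.
  by rewrite ler_pdivrMr //; lra.
by rewrite mulrA ltr_pdivrMr //; nra.
Qed.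

Lemma invn_small (e : R) : 0 < e -> exists N, forall n, (N <= n)%N -> n.+1%:R^-1 < e.
Proof.
move=> e0; exists (Num.truncn e^-1) => n Nn.
rewrite invf_plt ?posrE ?ltr0n //; apply: lt_le_trans (truncnS_gt _) _.
by rewrite ler_nat ltnS.
Qed.

End Sequences.

(** * Subgradients of block functions *)

Section BlockSubgradient.
Variables (R : realType) (P : nat) (ny : 'I_P -> nat).
Implicit Types (f : bvec R ny -> R) (x y z g : bvec R ny) (S : {set 'I_P}).

Lemma convex_subgrad_exists f x : convex_fun f -> exists g, is_subgrad f x g.
Proof.
move=> cf; pose T := {p : 'I_P & 'I_(ny p)}.
pose of_flat (u : T -> R) : bvec R ny := fun p l => u (existT _ p l).
have cf' : convex_coords R T (f \o of_flat) by move=> u v t; exact: cf.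
have [g hg] := subgradient_exists R T _ (fun c => x (tag c) (tagged c)) cf'.
exists (of_flat g) => z; have := hg (fun c => z (tag c) (tagged c)).
have -> // : bdot (of_flat g) (fun p l => z p l - x p l) =
    \sum_c g c * (z (tag c) (tagged c) - x (tag c) (tagged c)).
by rewrite /bdot sig_big_dep; apply: eq_bigr => -[p l].
Qed.

Lemma normr_le_bnorm g p l : `|g p l| <= bnorm g.
Proof.
rewrite -sqrtr_sqr ler_wsqrtr // /bdot (bigD1 p) //= (bigD1 l) //= expr2 -addrA lerDl.
by rewrite addr_ge0 //; do ?[apply: sumr_ge0 => *]; rewrite -expr2 sqr_ge0.
Qed.

(** Moving [y] along [g] in block [p] alone leaves [f] unchanged, so the subgradient inequality
    makes the squared norm of that block nonpositive. *)
Lemma subgrad_block_eq0 f S y g p l : depends_only f S -> is_subgrad f y g ->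
  p \notin S -> g p l = 0.
Proof.
move=> fS sg pS; pose z : bvec R ny := fun p' l' => y p' l' + (if p' == p then g p' l' else 0).
have fz : f z = f y.
  apply: fS => p' p'S; apply: funext => l'; rewrite /z; case: eqP => [pp|]; last by rewrite addr0.
  by rewrite -pp p'S in pS.
have := sg z; rewrite fz gerDl /bdot (bigD1 p) //= [X in _ + X]big1 ?addr0; last first.
  by move=> p' /negbTE pp; rewrite big1 // => l' _; rewrite /z pp addr0 subrr mulr0.
have H l' : 0 <= g p l' * (z p l' - y p l').
  by rewrite /z eqxx addrC addKr -expr2 sqr_ge0.
rewrite (bigD1 l) //= => h.
have : g p l * (z p l - y p l) <= 0.
  by apply: le_trans h; rewrite lerDl; apply: sumr_ge0.
rewrite /z eqxx addrC addKr -expr2 => h'.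
by apply/eqP; rewrite -sqrf_eq0 eq_le h' sqr_ge0.
Qed.

Variable L : R.

Lemma bdot_le_dist g x S (eps : bvec R ny) : bnorm g <= L ->
  (forall p l, p \notin S -> g p l = 0) ->
  (forall p l, 0 <= eps p l) ->
  (forall p l, p \in S -> `|x p l| <= eps p l) ->
  `|bdot g x| <= L * \sum_(p < P) \sum_(l < ny p) eps p l.
Proof.
move=> gL g0 eps0 xe; have L0 : 0 <= L by apply: le_trans gL; exact: sqrtr_ge0.
apply: le_trans (ler_norm_sum _ _ _) _; rewrite big_distrr /=; apply: ler_sum => p _.
apply: le_trans (ler_norm_sum _ _ _) _; rewrite big_distrr /=; apply: ler_sum => l _.
have [pS|pS] := boolP (p \in S); last by rewrite g0 // mul0r normr0 mulr_ge0.
by rewrite normrM ler_pM ?xe // (le_trans (normr_le_bnorm _ _ _) gL).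
Qed.

Variables (f : bvec R ny -> R) (S : {set 'I_P}).
Hypothesis f_convex : convex_fun f.
Hypothesis f_dep : depends_only f S.
Hypothesis f_subgrad : forall x g, is_subgrad f x g -> bnorm g <= L.

(** A subgradient at [x], tested at [y], bounds [f x - f y]. It vanishes off [S], so closeness is
    required only on the blocks in [S]. *)
Lemma convex_lipschitz x y (eps : bvec R ny) :
  (forall p l, 0 <= eps p l) ->
  (forall p l, p \in S -> `|x p l - y p l| <= eps p l) ->
  f x <= f y + L * \sum_(p < P) \sum_(l < ny p) eps p l.
Proof.
move=> eps0 xe; have [g sg] := convex_subgrad_exists f x f_convex.
have := sg y.
have : `|bdot g (fun p l => y p l - x p l)| <= L * \sum_(p < P) \sum_(l < ny p) eps p l.
  apply: (bdot_le_dist _ _ S) => //; first exact: f_subgrad sg.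
    by move=> p l; apply: subgrad_block_eq0 f_dep sg.
  by move=> p l pS; rewrite distrC xe.
rewrite ler_norml => /andP[h _]; lra.
Qed.

(** Two errors of the same size produce the factor 2: replacing [f yt] by [f zb], and replacing [yt]
    by [zb] in the scalar product. *)
Lemma subgrad_gap zb yt g x (eps : bvec R ny) :
  is_subgrad f yt g -> (forall p l, 0 <= eps p l) ->
  (forall p l, p \in S -> `|yt p l - zb p l| <= eps p l) ->
  f zb - f x - 2 * (L * \sum_(p < P) \sum_(l < ny p) eps p l) <=
    bdot g (fun p l => zb p l - x p l).
Proof.
move=> sg eps0 ye.
have h1 : f zb <= f yt + L * \sum_(p < P) \sum_(l < ny p) eps p l.
  by apply: convex_lipschitz => // p l pS; rewrite distrC ye.
have h2 := sg x.
have : `|bdot g (fun p l => yt p l - zb p l)| <= L * \sum_(p < P) \sum_(l < ny p) eps p l.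
  apply: (bdot_le_dist _ _ S) => //; first exact: f_subgrad sg.
  by move=> p l; apply: subgrad_block_eq0 f_dep sg.
have : bdot g (fun p l => zb p l - x p l) = - bdot g (fun p l => x p l - yt p l)
    - bdot g (fun p l => yt p l - zb p l).
  rewrite /bdot -!sumrN -big_split /=; apply: eq_bigr => p _.
  by rewrite -!sumrN -big_split /=; apply: eq_bigr => l _; ring.
move=> ->; rewrite ler_norml => /andP[_ h]; lra.
Qed.

End BlockSubgradient.

(** The weight [n] cancels the [1 / n] of the step in the cross term, so the blocks add up to one
    scalar product. For [n = 0] the hypothesis forces [G = 0]. *)
Lemma square_step_le (R : realType) (n : nat) (a G gamma L : R) : `|G| <= n%:R * L ->
  n%:R * (a - gamma * (G / n%:R)) ^+ 2 <=
    n%:R * a ^+ 2 - 2 * gamma * (a * G) + gamma ^+ 2 * (n%:R * L ^+ 2).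
Proof.
case: n => [|n] GL.
  by move: GL; rewrite !mul0r normr_le0 => /eqP ->; rewrite !mulr0 addr0 subr0.
have n0 : n.+1%:R != 0 :> R by rewrite pnatr_eq0.
have -> : n.+1%:R * (a - gamma * (G / n.+1%:R)) ^+ 2 =
   n.+1%:R * a ^+ 2 - 2 * gamma * (a * G) + gamma ^+ 2 * (G ^+ 2 / n.+1%:R).
  by field.
rewrite lerD2l ler_wpM2l ?sqr_ge0 // ler_pdivrMr ?ltr0n //.
rewrite -[G ^+ 2]real_normK ?num_real //.
have := normr_ge0 G; have := ltr0n R n.+1; nra.
Qed.

Lemma normr_le_sqr (R : realType) (a b : R) : 0 <= b -> a ^+ 2 <= b ^+ 2 -> `|a| <= b.
Proof. by move=> b0 ab; rewrite -[b]ger0_norm // -!sqrtr_sqr ler_wsqrtr. Qed.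

(** * Convergence *)

Theorem theorem4 (R : realType) (I P : nat) (ny : 'I_P -> nat)
  (f : 'I_I -> bvec R ny -> R) (N : 'I_I -> {set 'I_P}) (V : 'I_P -> {set 'I_I})
  (W : nat -> 'I_P -> 'I_I -> 'I_I -> R) (gamma : nat -> R)
  (nu L : R) (Q : nat)
  (q : nat -> 'I_I -> 'I_P -> R)
  (z w y yt g : nat -> 'I_I -> bvec R ny) :
  (* problem data *)
  (exists ys : bvec R ny, forall x, \sum_(i < I) f i ys <= \sum_(i < I) f i x) ->
  (forall i, depends_only (f i) (N i)) ->
  (forall p i, p \in N i -> i \in V p) ->
  (* weights *)
  (forall k p i j, i \in V p -> j \in V p -> 0 <= W k p i j) ->
  (forall k p i, i \in V p -> 0 < W k p i i) ->
  (forall k p j, j \in V p -> \sum_(i < I | i \in V p) W k p i j = 1) ->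
  0 < nu -> (forall k p i j, i \in V p -> j \in V p ->
    0 < W k p i j -> nu <= W k p i j) ->
  (0 < Q)%N ->
  (forall k p, strongly_connected (V p) (union_edge W V Q k p)) ->
  (* objectives *)
  (forall i, convex_fun (f i)) ->
  0 < L -> (forall i x gg, is_subgrad (f i) x gg -> bnorm gg <= L) ->
  (* step sizes *)
  (forall k, 0 < gamma k) -> (forall k, gamma k.+1 <= gamma k) ->
  (series gamma @ \oo --> +oo) ->
  cvgn (series (fun k => gamma k ^+ 2)) ->
  (* push-sum iteration *)
  (forall i p, i \in V p -> q 0 i p = 1) ->
  (forall k i p, i \in V p ->
     q k.+1 i p = \sum_(j < I | j \in V p) W k p i j * q k j p) ->
  (forall k i p, i \in V p -> forall l,
     w k.+1 i p l = \sum_(j < I | j \in V p) W k p i j * z k j p l) ->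
  (forall k i p, i \in V p -> forall l, y k.+1 i p l = w k.+1 i p l / q k.+1 i p) ->
  (forall k i p, i \in V p -> yt k.+1 i p = y k.+1 i p) ->
  (forall k i, is_subgrad (f i) (yt k.+1 i) (g k.+1 i)) ->
  (forall k i p, i \in V p -> forall l,
     z k.+1 i p l = w k.+1 i p l - gamma k * g k.+1 i p l) ->
  exists ys : bvec R ny,
    (forall x, \sum_(i < I) f i ys <= \sum_(i < I) f i x) /\
    (forall p i, i \in V p -> forall l, (fun k => y k i p l) @ \oo --> ys p l).
Proof.
move=> [xs xs_min] f_dep NV W_ge0 W_diag W_col nu_gt0 W_edge Q_gt0 W_conn f_cvx L_gt0
  f_sub gamma_gt0 gamma_mono gamma_div gamma_sq q_init q_step w_step y_step yt_y g_sub z_step.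
have L_ge0 := ltW L_gt0; have gamma_ge0 k := ltW (gamma_gt0 k).
pose F x := \sum_(i < I) f i x.
pose T := {p : 'I_P & 'I_(ny p)}.
have g_le k i p l : `|g k.+1 i p l| <= L.
  exact: le_trans (normr_le_bnorm _ _ _ _ _ _) (f_sub _ _ _ (g_sub k i)).
have g0 k i p l : i \notin V p -> g k.+1 i p l = 0.
  move=> iV; apply: (subgrad_block_eq0 _ _ _ (f i) (N i)) (g_sub k i) _ => //.
  by apply: contra iV => /NV.
have [G hG] : exists G, forall n, \sum_(k < n) gamma k ^+ 2 <= G.
  exists (limn (series (fun k => gamma k ^+ 2))) => n.
  have := @nondecreasing_cvgn_le _ (series (fun k => gamma k ^+ 2)) _ gamma_sq n.
  rewrite /series /= big_mkord; apply.
  by apply/nondecreasing_seqP => m; rewrite /series /= big_nat_recr //= lerDl sqr_ge0.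
have div A : exists N0, forall n, (N0 <= n)%N -> A <= \sum_(k < n) gamma k.
  have /cvgryPge/(_ A)[N0 _ hN0] := gamma_div.
  by exists N0 => n /hN0; rewrite /series /= big_mkord.
(* For empty [V p], division by 0 makes this block 0; by [NV] no [f i] depends on it. *)
pose zb k : bvec R ny := fun p l => (\sum_(i in V p) z k i p l) / #|V p|%:R.
have consensus (c : T) : exists E : nat -> R, [/\ forall k, 0 <= E k,
    exists K, forall n, \sum_(k < n) E k ^+ 2 <= K &
    forall k i, i \in V (tag c) ->
      `|y k.+1 i (tag c) (tagged c) - zb k (tag c) (tagged c)| <= E k].
  case: c => p l /=.
  apply: (@push_sum_consensus R I (V p) (fun k => W k p) nu Q (fun k i => q k i p)
    (fun k i => z k i p l) (fun k i => w k i p l) (fun k i => y k i p l)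
    (fun k i => gamma k * g k.+1 i p l) (fun k => gamma k * L) _ _ _ _ _ _ _ _ _ _ _ _ _ _
    (L ^+ 2 * G)) => //.
  - by move=> k i j; exact: W_ge0.
  - by move=> k i; exact: W_diag.
  - by move=> k j; exact: W_col.
  - by move=> k i j; exact: W_edge.
  - by move=> k; exact: W_conn.
  - by move=> i; exact: q_init.
  - by move=> k i; exact: q_step.
  - by move=> k i iV; exact: w_step.
  - by move=> k i iV; exact: y_step.
  - by move=> k i iV; exact: z_step.
  - by move=> k i iV; rewrite normrM ger0_norm // ler_wpM2l.
  - by move=> k; rewrite ler_wpM2r.
  - move=> n; rewrite [leLHS](_ : _ = L ^+ 2 * \sum_(k < n) gamma k ^+ 2).
      by rewrite ler_wpM2l ?sqr_ge0.
    by rewrite big_distrr /=; apply: eq_bigr => k _; rewrite exprMn mulrC.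
have [E hE] := choice consensus.
pose eps k : bvec R ny := fun p l => E (existT _ p l) k.
have eps0 k p l : 0 <= eps k p l by have [E0 _ _] := hE (existT _ p l); exact: E0.
have y_zb k i p l : i \in V p -> `|y k.+1 i p l - zb k p l| <= eps k p l.
  by have [_ _] := hE (existT _ p l); exact.
pose D x k := \sum_(p < P) \sum_(l < ny p) #|V p|%:R * (zb k p l - x p l) ^+ 2.
pose S k := \sum_(p < P) \sum_(l < ny p) eps k p l.
pose C := \sum_(p < P) \sum_(l < ny p) #|V p|%:R * L ^+ 2.
have S0 k : 0 <= S k by do 2![apply: sumr_ge0 => ? _].
have C0 : 0 <= C by do 2![apply: sumr_ge0 => ? _]; rewrite mulr_ge0 ?sqr_ge0.
have zb_step k p l :
    zb k.+1 p l = zb k p l - gamma k * ((\sum_(i in V p) g k.+1 i p l) / #|V p|%:R).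
  rewrite /zb mulrA -mulrBl; congr (_ / _).
  rewrite -(sum_column_stochastic R I (V p) (fun k => W k p) (fun k => W_col k p) k
    (fun i => z k i p l)).
  rewrite big_distrr -sumrB /=; apply: eq_bigr => i iV.
  by rewrite z_step // w_step.
(* [h1] expands the squares and [h2] sums [subgrad_gap] over the agents. The factor 4 is the 2 of
   the cross term times the 2 of the gap. *)
have descent x k : D x k.+1 <= D x k - 2 * gamma k * (F (zb k) - F x) +
    (4 * (I%:R * L) * (gamma k * S k) + C * gamma k ^+ 2).
  have h1 : D x k.+1 <= D x k - 2 * gamma k *
      (\sum_(i < I) bdot (g k.+1 i) (fun p l => zb k p l - x p l)) + C * gamma k ^+ 2.
    have -> : \sum_(i < I) bdot (g k.+1 i) (fun p l => zb k p l - x p l) =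
        \sum_(p < P) \sum_(l < ny p) (zb k p l - x p l) * \sum_(i in V p) g k.+1 i p l.
      rewrite /bdot exchange_big /=; apply: eq_bigr => p _.
      rewrite exchange_big /=; apply: eq_bigr => l _.
      rewrite big_distrr /= [RHS]big_mkcond /=; apply: eq_bigr => i _.
      by case: ifPn => [_|iV]; [rewrite mulrC | rewrite g0 ?mul0r].
    rewrite /D /C big_distrr /= -sumrB big_distrl -big_split /=; apply: ler_sum => p _.
    rewrite big_distrr /= -sumrB big_distrl -big_split /=; apply: ler_sum => l _.
    rewrite zb_step addrAC [#|V p|%:R * L ^+ 2 * _]mulrC; apply: square_step_le.
    apply: le_trans (ler_norm_sum _ _ _) _; rewrite mulr_natl -sumr_const.
    by apply: ler_sum => i _.
  have h2 : F (zb k) - F x - 2 * (I%:R * L) * S k <=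
      \sum_(i < I) bdot (g k.+1 i) (fun p l => zb k p l - x p l).
    have -> : F (zb k) - F x - 2 * (I%:R * L) * S k =
        \sum_(i < I) (f i (zb k) - f i x - 2 * (L * S k)).
      by rewrite !sumrB sumr_const card_ord -mulr_natl /F; ring.
    apply: ler_sum => i _.
    apply: (subgrad_gap _ _ _ L (f i) (N i)) (g_sub k i) _ _ => //; first exact: f_sub.
    by move=> p l /NV iV; rewrite yt_y // y_zb.
  have := ler_wpM2l (gamma_ge0 k) h2; lra.
pose c k := 4 * (I%:R * L) * (gamma k * S k) + C * gamma k ^+ 2.
have c0 k : 0 <= c k by rewrite addr_ge0 ?mulr_ge0 ?sqr_ge0.
(* Each product [gamma k * E t k] is at most [gamma k ^+ 2 + E t k ^+ 2], and both squares are
   summable. *)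
have [Kc hKc] : exists K, forall n, \sum_(k < n) c k <= K.
  have E_sq t : exists K, forall n, \sum_(k < n) E t k ^+ 2 <= K by have [] := hE t.
  have [K' hK'] := choice E_sq.
  exists (4 * (I%:R * L) * (\sum_t (G + K' t)) + C * G) => n.
  rewrite /c big_split /= -!big_distrr /= lerD ?ler_wpM2l ?mulr_ge0 ?hG //.
  have -> : \sum_(k < n) gamma k * S k = \sum_(t : T) \sum_(k < n) gamma k * E t k.
    rewrite exchange_big /=; apply: eq_bigr => k _.
    by rewrite -big_distrr /= /S sig_big_dep; congr (_ * _); apply: eq_bigr => -[p l].
  apply: ler_sum => t _; apply: le_trans (lerD (hG n) (hK' t n)).
  rewrite -big_split /=; apply: ler_sum => k _.
  by have [E0 _ _] := hE t; have := E0 k; have := gamma_ge0 k; nra.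
have fejer x k : (forall x', F x <= F x') -> D x k.+1 <= D x k + c k.
  move=> /(_ (zb k)) xmin; apply: le_trans (descent x k) _; rewrite lerD2r gerBl.
  by rewrite !mulr_ge0 // subr_ge0.
have D0 x k : 0 <= D x k.
  by do 2![apply: sumr_ge0 => ? _]; rewrite mulr_ge0 ?sqr_ge0.
have gap0 k : 0 <= F (zb k) - F xs by rewrite subr_ge0 xs_min.
have DK n : D xs n + 2 * \sum_(k < n) gamma k * (F (zb k) - F xs) <= D xs 0 + Kc.
  apply: le_trans (_ : _ <= D xs 0 + \sum_(k < n) c k) _; last by rewrite lerD2l.
  elim: n => [|n IH]; first by rewrite !big_ord0 mulr0.
  by rewrite !big_ord_recr /=; have := descent xs n; rewrite -/(c n); lra.
have gap_sum n : \sum_(k < n) gamma k * (F (zb k) - F xs) <= D xs 0 + Kc.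
  have := DK n; have := D0 xs n.
  have : 0 <= \sum_(k < n) gamma k * (F (zb k) - F xs).
    by apply: sumr_ge0 => k _; rewrite mulr_ge0.
  lra.
have D_le n : D xs n <= D xs 0 + Kc.
  have := DK n.
  have : 0 <= \sum_(k < n) gamma k * (F (zb k) - F xs).
    by apply: sumr_ge0 => k _; rewrite mulr_ge0.
  lra.
have coord x k p l : (0 < #|V p|)%N -> (zb k p l - x p l) ^+ 2 <= D x k.
  move=> V0; rewrite /D (bigD1 p) //= (bigD1 l) //= -addrA.
  apply: le_trans (_ : _ <= #|V p|%:R * (zb k p l - x p l) ^+ 2) _.
    by rewrite ler_peMl ?sqr_ge0 // ler1n.
  rewrite lerDl addr_ge0 //; do ?[apply: sumr_ge0 => ? _]; by rewrite mulr_ge0 ?sqr_ge0.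
have liminf := weighted_liminf R gamma (fun k => F (zb k) - F xs) _ gamma_gt0 gap0 div gap_sum.
have close n : exists k, (n <= k)%N /\ F (zb k) - F xs < n.+1%:R^-1.
  have n0 : 0 < n.+1%:R^-1 :> R by rewrite invr_gt0 ltr0n.
  by have [k nk hk] := liminf _ n n0; exists k.
have [phi hphi] := choice close.
(* The squared distance to [xs] is at most [D xs 0 + Kc], so the distance is at most 1 plus that
   number; this avoids a square root. *)
pose M := \sum_(t : T) `|xs (tag t) (tagged t)| + (1 + (D xs 0 + Kc)).
have DK0 : 0 <= D xs 0 + Kc by apply: le_trans (D_le 0%N).
have zb_M n (t : T) : `|zb (phi n) (tag t) (tagged t)| <= M.
  case: t => p l /=.
  have xs_le : `|xs p l| <= \sum_(t : T) `|xs (tag t) (tagged t)|.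
    by rewrite (bigD1 (existT _ p l)) //= lerDl; apply: sumr_ge0.
  rewrite /M.
  have [V0|V0] := posnP #|V p|.
    rewrite /zb V0 invr0 mulr0 normr0.
    by have := normr_ge0 (xs p l); lra.
  have h := le_trans (coord xs (phi n) p l V0) (D_le _).
  have h1 : `|zb (phi n) p l - xs p l| <= 1 + (D xs 0 + Kc).
    by apply: normr_le_sqr; [rewrite addr_ge0 | apply: le_trans h _; nra].
  have := ler_normD (zb (phi n) p l - xs p l) (xs p l); rewrite subrK; lra.
have [a ha] := bounded_cluster_point R T _ M zb_M.
pose ys : bvec R ny := fun p l => a (existT _ p l).
pose m : R := \sum_(p < P) \sum_(l < ny p) 1.
have m0 : 0 <= m by do 2![apply: sumr_ge0 => ? _].
have mE (d : R) : \sum_(p < P) \sum_(l < ny p) d = m * d.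
  rewrite /m big_distrl /=; apply: eq_bigr => p _.
  by rewrite big_distrl /=; apply: eq_bigr => l _; rewrite mul1r.
have near_ys d K : 0 < d -> exists n, [/\ (K <= n)%N, (n <= phi n)%N,
    F (zb (phi n)) - F xs < n.+1%:R^-1 & forall p l, `|zb (phi n) p l - ys p l| <= d].
  move=> d0; have [n Kn hn] := ha d K d0; have [h1 h2] := hphi n.
  by exists n; split => // p l; have /ltW := hn (existT _ p l).
(* Half of [e] pays for moving from [zb (phi n)] to [ys] by the Lipschitz bound, half for the
   optimality gap at [phi n]. *)
have ys_min : F ys <= F xs.
  apply/ler_addgt0Pr => e e0; have e20 : 0 < e / 2 by rewrite divr_gt0.
  have ILm : 0 <= I%:R * L * m by rewrite !mulr_ge0.
  have [d [d0 _ dC]] := small_multiplier R _ _ ILm e20.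
  have [K hK] := invn_small R _ e20.
  have [n [Kn _ Fn hn]] := near_ys d K d0.
  have : F ys <= F (zb (phi n)) + I%:R * L * m * d.
    have -> : F (zb (phi n)) + I%:R * L * m * d = \sum_(i < I) (f i (zb (phi n)) + L * (m * d)).
      by rewrite big_split /= sumr_const card_ord -mulr_natl /F; ring.
    apply: ler_sum => i _; rewrite -mE.
    apply: (convex_lipschitz _ _ _ L (f i) (N i) (f_cvx i) (f_dep i) (f_sub i) _ _ (fun _ _ => d)).
      by move=> *; exact: ltW.
    by move=> p l _; rewrite distrC.
  move: Fn dC (hK n Kn); move: n.+1%:R^-1 (I%:R * L * m * d) => ? ?; lra.
have ys_opt x : F ys <= F x by apply: le_trans ys_min (xs_min x).
(* Near the cluster point each of the [m] coordinates contributes at most [I%:R * d], using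
   [#|V p| <= I] and [d <= 1]. *)
have D_inf e K : 0 < e -> exists2 k, (K <= k)%N & D ys k < e.
  move=> e0; have Im : 0 <= I%:R * m by rewrite mulr_ge0.
  have [d [d0 d1 dC]] := small_multiplier R _ _ Im e0.
  have [n [Kn nphi _ hn]] := near_ys d K d0.
  exists (phi n); first exact: leq_trans nphi.
  apply: le_lt_trans dC; rewrite -mulrA mulrCA -mE /D; apply: ler_sum => p _; apply: ler_sum => l _.
  rewrite ler_pM ?sqr_ge0 //.
    by rewrite ler_nat -[leqRHS]card_ord max_card.
  rewrite -real_normK ?num_real //.
  by have := hn p l; have := normr_ge0 (zb (phi n) p l - ys p l); nra.
have D_small := quasi_fejer R (D ys) c Kc c0 hKc (fun k => fejer ys k ys_opt) D_inf.
exists ys; split => // p i iV l.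
apply/cvgrPdist_le => e e0; have e20 : 0 < e / 2 by rewrite divr_gt0.
have [E0 [K hK] _] := hE (existT _ p l).
have [N1 hN1] := D_small _ (exprn_gt0 2 e20).
have [N2 hN2] := sum_bounded_small R (fun k => eps k p l ^+ 2) K
  (fun k => sqr_ge0 _) hK _ (exprn_gt0 2 e20).
(* The successor excludes index 0, where nothing constrains [y], and pairs [y k.+1] with [zb k]. *)
exists (N1 + N2).+1 => // -[//|k] /=; rewrite ltnS => Nk.
have V0 : (0 < #|V p|)%N by apply/card_gt0P; exists i.
have h1 : `|zb k p l - ys p l| <= e / 2.
  apply: normr_le_sqr; first exact: ltW.
  by apply: le_trans (coord ys k p l V0) (hN1 k (leq_trans (leq_addr _ _) Nk)).
have h2 : eps k p l <= e / 2.
  rewrite -[eps k p l]ger0_norm //; apply: normr_le_sqr; first exact: ltW.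
  exact: hN2 (leq_trans (leq_addl _ _) Nk).
have h3 := y_zb k i p l iV.
have := ler_normD (y k.+1 i p l - zb k p l) (zb k p l - ys p l).
rewrite addrA subrK => h4; rewrite distrC; lra.
Qed.
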